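(* Let $\mathcal{C}$ be a symmetric monoidal category and let $(g,v,p)$, with $g\colon B\to B'$, $v\colon X\to X'$, $p\colon A\to A'$, be a morphism of split extensions of bialgebras in $\mathcal{C}$ from $(X,A,B,\kappa,\alpha,e,\lambda)$ to $(X',A',B',\kappa',\alpha',e',\lambda')$. Then $p$ is an isomorphism whenever $v$ and $g$ are isomorphisms.
   Context: $(\mathcal{C},\otimes,I,\sigma)$ is a symmetric monoidal category (associativity and unit isomorphisms are suppressed); $f\cdot g$ denotes composition ($g$ first) and $1_X$ the identity of $X$. An algebra is an object $A$ with morphisms $m\colon A\otimes A\to A$, $u_A\colon I\to A$ with $m\cdot(u_A\otimes 1_A)=1_A=m\cdot(1_A\otimes u_A)$; associativity is NOT required. Algebra morphisms preserve $m$ and $u$. A coalgebra $(C,\Delta,\epsilon_C)$ is coassociative and counital; coalgebra morphisms preserve $\Delta$ and $\epsilon$. A bialgebra (meaning non-associative bialgebra) is $(B,m,u_B,\Delta,\epsilon_B)$, with $(B,m,u_B)$ an algebra, $(B,\Delta,\epsilon_B)$ a coalgebra, and $\Delta\cdot m=(m\otimes m)\cdot(1_B\otimes\sigma_{B,B}\otimes 1_B)\cdot(\Delta\otimes\Delta)$, $\Delta\cdot u_B=u_B\otimes u_B$, $\epsilon_B\cdot m=\epsilon_B\otimes\epsilon_B$, $\epsilon_B\cdot u_B=1_I$. A bialgebra morphism is a morphism of algebras and of coalgebras. Split extension of bialgebras: bialgebras $X,A,B$, bialgebra morphisms $\kappa\colon X\to A$, $\alpha\colon A\to B$, $e\colon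 B\to A$ and a morphism $\lambda\colon A\to X$ in $\mathcal{C}$ such that (1) $\lambda\cdot\kappa=1_X$, $\alpha\cdot e=1_B$; (2) $\lambda\cdot e=u_X\cdot\epsilon_B$, $\alpha\cdot\kappa=u_B\cdot\epsilon_X$; (3) $m\cdot((\kappa\cdot\lambda)\otimes(e\cdot\alpha))\cdot\Delta=1_A$; (4) $\lambda\cdot m\cdot(\kappa\otimes e)=1_X\otimes\epsilon_B$; (5) $(1_B\otimes\lambda)\cdot(1_B\otimes m)\cdot(1_B\otimes e\otimes\kappa)\cdot(\Delta\otimes 1_X)=(1_B\otimes\lambda)\cdot(1_B\otimes m)\cdot(1_B\otimes e\otimes\kappa)\cdot(\sigma_{B,B}\otimes 1_X)\cdot(\Delta\otimes 1_X)$; (6) $m\cdot(m\otimes 1_A)\cdot(\kappa\otimes e\otimes 1_A)=m\cdot(1_A\otimes m)\cdot(\kappa\otimes e\otimes 1_A)$; (7) $m\cdot(m\otimes 1_A)\cdot(\kappa\otimes 1_A\otimes e)=m\cdot(1_A\otimes m)\cdot(\kappa\otimes 1_A\otimes e)$; (8) $m\cdot(m\otimes 1_A)\cdot(1_A\otimes\kappa\otimes e)=m\cdot(1_A\otimes m)\cdot(1_A\otimes\kappa\otimes e)$; (9) $\lambda$ is a morphism of coalgebras preserving the unit. A morphism from $(X,A,B,\kappa,\alpha,e,\lambda)$ to $(X',A',B',\kappa',\alpha',e',\lambda')$ is a triple $(g,v,p)$ of bialgebra morphisms $g\colon B\to B'$, $v\colon X\to X'$, $p\colon A\to A'$ with $p\cdot\kappa=\kappa'\cdot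 v$, $p\cdot e=e'\cdot g$, $\alpha'\cdot p=g\cdot\alpha$, $\lambda'\cdot p=v\cdot\lambda$. *)

(* Defs.v *)
Set Implicit Arguments.
Unset Strict Implicit.
Unset Printing Implicit Defensive.

Declare Scope cat_scope.
Delimit Scope cat_scope with cat.
Global Open Scope cat_scope.

Reserved Notation "g ∘ f" (at level 45, left associativity).
Reserved Notation "A ⊗ B" (at level 40, left associativity).
Reserved Notation "f ⊗₁ g" (at level 40, left associativity).

Record category := Category {
  ob :> Type;
  hom : ob -> ob -> Type;
  idm : forall A : ob, hom A A;
  comp : forall A B C : ob, hom B C -> hom A B -> hom A C
    where "g ∘ f" := (comp g f);
  comp_idl : forall (A B : ob) (f : hom A B), idm B ∘ f = f;
  comp_idr : forall (A B : ob) (f : hom A B), f ∘ idm A = f;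
  compA : forall (A B C D : ob) (h : hom C D) (g : hom B C) (f : hom A B),
    h ∘ (g ∘ f) = (h ∘ g) ∘ f
}.

Arguments hom {c} A B.
Arguments idm {c} A.
Arguments comp {c A B C} g f.

Notation "g ∘ f" := (comp g f) : cat_scope.

(* The tensor product is not assumed to be strict. *)
Record sym_mon_cat := SymMonCat {
  smc_cat :> category;
  tens : smc_cat -> smc_cat -> smc_cat
    where "A ⊗ B" := (tens A B);
  tensh : forall A A' B B' : smc_cat,
    hom A A' -> hom B B' -> hom (A ⊗ B) (A' ⊗ B')
    where "f ⊗₁ g" := (tensh f g);
  tens_id : forall A B : smc_cat, idm A ⊗₁ idm B = idm (A ⊗ B);
  tens_comp : forall (A A' A'' B B' B'' : smc_cat)
    (f' : hom A' A'') (f : hom A A') (g' : hom B' B'') (g : hom B B'),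
    (f' ∘ f) ⊗₁ (g' ∘ g) = (f' ⊗₁ g') ∘ (f ⊗₁ g);
  munit : smc_cat;
  assoc : forall A B C : smc_cat, hom ((A ⊗ B) ⊗ C) (A ⊗ (B ⊗ C));
  assoc_inv : forall A B C : smc_cat, hom (A ⊗ (B ⊗ C)) ((A ⊗ B) ⊗ C);
  assocK : forall A B C : smc_cat,
    assoc_inv A B C ∘ assoc A B C = idm ((A ⊗ B) ⊗ C);
  assocVK : forall A B C : smc_cat,
    assoc A B C ∘ assoc_inv A B C = idm (A ⊗ (B ⊗ C));
  assoc_nat : forall (A A' B B' C C' : smc_cat)
    (f : hom A A') (g : hom B B') (h : hom C C'),
    assoc A' B' C' ∘ ((f ⊗₁ g) ⊗₁ h) = (f ⊗₁ (g ⊗₁ h)) ∘ assoc A B C;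
  lunit : forall A : smc_cat, hom (munit ⊗ A) A;
  lunit_inv : forall A : smc_cat, hom A (munit ⊗ A);
  lunitK : forall A : smc_cat, lunit_inv A ∘ lunit A = idm (munit ⊗ A);
  lunitVK : forall A : smc_cat, lunit A ∘ lunit_inv A = idm A;
  lunit_nat : forall (A B : smc_cat) (f : hom A B),
    lunit B ∘ (idm munit ⊗₁ f) = f ∘ lunit A;
  runit : forall A : smc_cat, hom (A ⊗ munit) A;
  runit_inv : forall A : smc_cat, hom A (A ⊗ munit);
  runitK : forall A : smc_cat, runit_inv A ∘ runit A = idm (A ⊗ munit);
  runitVK : forall A : smc_cat, runit A ∘ runit_inv A = idm A;
  runit_nat : forall (A B : smc_cat) (f : hom A B),
    runit B ∘ (f ⊗₁ idm munit) = f ∘ runit A;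
  pentagon : forall A B C D : smc_cat,
    assoc A B (C ⊗ D) ∘ assoc (A ⊗ B) C D
    = (idm A ⊗₁ assoc B C D) ∘ assoc A (B ⊗ C) D ∘ (assoc A B C ⊗₁ idm D);
  triangle : forall A B : smc_cat,
    (idm A ⊗₁ lunit B) ∘ assoc A munit B = runit A ⊗₁ idm B;
  sym : forall A B : smc_cat, hom (A ⊗ B) (B ⊗ A);
  sym_nat : forall (A A' B B' : smc_cat) (f : hom A A') (g : hom B B'),
    sym A' B' ∘ (f ⊗₁ g) = (g ⊗₁ f) ∘ sym A B;
  symK : forall A B : smc_cat, sym B A ∘ sym A B = idm (A ⊗ B);
  hexagon : forall A B C : smc_cat,
    assoc B C A ∘ sym A (B ⊗ C) ∘ assoc A B C
    = (idm B ⊗₁ sym A C) ∘ assoc B A C ∘ (sym A B ⊗₁ idm C)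
}.

Arguments tens {s} A B.
Arguments tensh {s A A' B B'} f g.
Arguments munit {s}.
Arguments assoc {s} A B C.
Arguments assoc_inv {s} A B C.
Arguments lunit {s} A.
Arguments lunit_inv {s} A.
Arguments runit {s} A.
Arguments runit_inv {s} A.
Arguments sym {s} A B.

Notation "A ⊗ B" := (tens A B) : cat_scope.
Notation "f ⊗₁ g" := (tensh f g) : cat_scope.

(* 1 ⊗ σ ⊗ 1, with its associativity isomorphisms made explicit. *)
Definition mid_swap (C : sym_mon_cat) (P Q R S : C) :
    hom ((P ⊗ Q) ⊗ (R ⊗ S)) ((P ⊗ R) ⊗ (Q ⊗ S)) :=
  assoc_inv P R (Q ⊗ S)
  ∘ (idm P ⊗₁ (assoc R Q S ∘ (sym Q R ⊗₁ idm S) ∘ assoc_inv Q R S))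
  ∘ assoc P Q (R ⊗ S).

(* Unital, but not necessarily associative. *)
Record algebra_on (C : sym_mon_cat) (A : C) := AlgebraOn {
  alg_mul : hom (A ⊗ A) A;
  alg_unit : hom munit A;
  alg_unitl : alg_mul ∘ (alg_unit ⊗₁ idm A) = lunit A;
  alg_unitr : alg_mul ∘ (idm A ⊗₁ alg_unit) = runit A
}.

Record coalgebra_on (C : sym_mon_cat) (A : C) := CoalgebraOn {
  coalg_comul : hom A (A ⊗ A);
  coalg_counit : hom A munit;
  coalg_coassoc :
    assoc A A A ∘ (coalg_comul ⊗₁ idm A) ∘ coalg_comul
    = (idm A ⊗₁ coalg_comul) ∘ coalg_comul;
  coalg_counitl : lunit A ∘ (coalg_counit ⊗₁ idm A) ∘ coalg_comul = idm A;
  coalg_counitr : runit A ∘ (idm A ⊗₁ coalg_counit) ∘ coalg_comul = idm A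
}.

Record is_alg_hom (C : sym_mon_cat) (A B : C)
    (a : algebra_on A) (b : algebra_on B) (f : hom A B) : Prop := IsAlgHom {
  alg_hom_mul : f ∘ alg_mul a = alg_mul b ∘ (f ⊗₁ f);
  alg_hom_unit : f ∘ alg_unit a = alg_unit b
}.

Record is_coalg_hom (C : sym_mon_cat) (A B : C)
    (a : coalgebra_on A) (b : coalgebra_on B) (f : hom A B) : Prop :=
IsCoalgHom {
  coalg_hom_comul : coalg_comul b ∘ f = (f ⊗₁ f) ∘ coalg_comul a;
  coalg_hom_counit : coalg_counit b ∘ f = coalg_counit a
}.

Record bialgebra (C : sym_mon_cat) := Bialgebra {
  bialg_ob :> C;
  bialg_alg : algebra_on bialg_ob;
  bialg_coalg : coalgebra_on bialg_ob;
  bialg_comul_mul :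
    coalg_comul bialg_coalg ∘ alg_mul bialg_alg
    = (alg_mul bialg_alg ⊗₁ alg_mul bialg_alg)
      ∘ mid_swap bialg_ob bialg_ob bialg_ob bialg_ob
      ∘ (coalg_comul bialg_coalg ⊗₁ coalg_comul bialg_coalg);
  bialg_comul_unit :
    coalg_comul bialg_coalg ∘ alg_unit bialg_alg
    = (alg_unit bialg_alg ⊗₁ alg_unit bialg_alg) ∘ lunit_inv munit;
  bialg_counit_mul :
    coalg_counit bialg_coalg ∘ alg_mul bialg_alg
    = lunit munit ∘ (coalg_counit bialg_coalg ⊗₁ coalg_counit bialg_coalg);
  bialg_counit_unit :
    coalg_counit bialg_coalg ∘ alg_unit bialg_alg = idm munit
}.

Section BialgebraOperations.
Variables (C : sym_mon_cat) (B : bialgebra C).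
Definition bmul : hom (B ⊗ B) B := alg_mul (bialg_alg B).
Definition bunit : hom munit B := alg_unit (bialg_alg B).
Definition bcomul : hom B (B ⊗ B) := coalg_comul (bialg_coalg B).
Definition bcounit : hom B munit := coalg_counit (bialg_coalg B).
End BialgebraOperations.

Record bialg_hom (C : sym_mon_cat) (A B : bialgebra C) := BialgHom {
  bialg_mor :> hom A B;
  bialg_hom_alg : is_alg_hom (bialg_alg A) (bialg_alg B) bialg_mor;
  bialg_hom_coalg : is_coalg_hom (bialg_coalg A) (bialg_coalg B) bialg_mor
}.

(* Isomorphism in the category of bialgebras: the inverse is required to be a
   bialgebra morphism. *)
Definition is_bialg_iso (C : sym_mon_cat) (A B : bialgebra C)
    (f : bialg_hom A B) : Prop :=
  exists h : bialg_hom B A, h ∘ f = idm A /\ f ∘ h = idm B.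

Record split_ext (C : sym_mon_cat) := SplitExt {
  seX : bialgebra C;
  seA : bialgebra C;
  seB : bialgebra C;
  kappa : bialg_hom seX seA;
  alpha : bialg_hom seA seB;
  sec : bialg_hom seB seA;
  lambda : hom seA seX;
  lambda_kappa : lambda ∘ kappa = idm seX;
  alpha_sec : alpha ∘ sec = idm seB;
  lambda_sec : lambda ∘ sec = bunit seX ∘ bcounit seB;
  alpha_kappa : alpha ∘ kappa = bunit seB ∘ bcounit seX;
  split_decomp :
    bmul seA ∘ ((kappa ∘ lambda) ⊗₁ (sec ∘ alpha)) ∘ bcomul seA = idm seA;
  lambda_mul :
    lambda ∘ bmul seA ∘ (kappa ⊗₁ sec) = runit seX ∘ (idm seX ⊗₁ bcounit seB);
  split_cocomm :
    (idm seB ⊗₁ lambda) ∘ (idm seB ⊗₁ bmul seA) ∘ (idm seB ⊗₁ (sec ⊗₁ kappa))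
      ∘ assoc seB seB seX ∘ (bcomul seB ⊗₁ idm seX)
    = (idm seB ⊗₁ lambda) ∘ (idm seB ⊗₁ bmul seA) ∘ (idm seB ⊗₁ (sec ⊗₁ kappa))
      ∘ assoc seB seB seX ∘ (sym seB seB ⊗₁ idm seX)
      ∘ (bcomul seB ⊗₁ idm seX);
  split_assoc_kea :
    bmul seA ∘ (bmul seA ⊗₁ idm seA) ∘ ((kappa ⊗₁ sec) ⊗₁ idm seA)
    = bmul seA ∘ (idm seA ⊗₁ bmul seA) ∘ assoc seA seA seA
      ∘ ((kappa ⊗₁ sec) ⊗₁ idm seA);
  split_assoc_kae :
    bmul seA ∘ (bmul seA ⊗₁ idm seA) ∘ ((kappa ⊗₁ idm seA) ⊗₁ sec)
    = bmul seA ∘ (idm seA ⊗₁ bmul seA) ∘ assoc seA seA seA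
      ∘ ((kappa ⊗₁ idm seA) ⊗₁ sec);
  split_assoc_ake :
    bmul seA ∘ (bmul seA ⊗₁ idm seA) ∘ ((idm seA ⊗₁ kappa) ⊗₁ sec)
    = bmul seA ∘ (idm seA ⊗₁ bmul seA) ∘ assoc seA seA seA
      ∘ ((idm seA ⊗₁ kappa) ⊗₁ sec);
  lambda_coalg : is_coalg_hom (bialg_coalg seA) (bialg_coalg seX) lambda;
  lambda_unit : lambda ∘ bunit seA = bunit seX
}.

Arguments kappa {C} s.
Arguments alpha {C} s.
Arguments sec {C} s.
Arguments lambda {C} s.

Record is_split_ext_hom (C : sym_mon_cat) (E E' : split_ext C)
    (g : bialg_hom (seB E) (seB E')) (v : bialg_hom (seX E) (seX E'))
    (p : bialg_hom (seA E) (seA E')) : Prop := IsSplitExtHom {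
  split_hom_kappa : p ∘ kappa E = kappa E' ∘ v;
  split_hom_sec : p ∘ sec E = sec E' ∘ g;
  split_hom_alpha : alpha E' ∘ p = g ∘ alpha E;
  split_hom_lambda : lambda E' ∘ p = v ∘ lambda E
}.

(* Main.v *)
Require Import Defs.

(** Axiom (3) reconstructs [A] from [lambda] and [alpha], so the inverse of [p]
    must be [m_A ∘ (kappa v^-1 lambda' ⊗ sec g^-1 alpha') ∘ Delta_A'];
    both composites with [p] reduce to axiom (3), for [E'] and for [E]. *)

(** Left cancellation of a split mono; it turns an equation to be proved for an inverse into the
    known one for [p]. *)
Lemma mono_split_inv {C : category} {A B : C} {p : hom A B} {q : hom B A}
    (qp : q ∘ p = idm A) {D : C} (f f' : hom D A) :
  p ∘ f = p ∘ f' -> f = f'.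
Proof.
  intros H.
  rewrite <- (comp_idl f), <- (comp_idl f'), <- qp, <- !compA, H.
  reflexivity.
Qed.

Lemma alg_hom_inverse {C : sym_mon_cat} {A B : C}
    {a : algebra_on A} {b : algebra_on B} {p : hom A B} {q : hom B A} :
  is_alg_hom a b p -> q ∘ p = idm A -> p ∘ q = idm B -> is_alg_hom b a q.
Proof.
  intros [pm pu] qp pq; split; apply (mono_split_inv qp).
  - rewrite !compA, pq, comp_idl, pm, <- compA, <- tens_comp, pq, tens_id.
    symmetry; apply comp_idr.
  - rewrite compA, pq, comp_idl; symmetry; exact pu.
Qed.

Lemma coalg_hom_inverse {C : sym_mon_cat} {A B : C}
    {a : coalgebra_on A} {b : coalgebra_on B} {p : hom A B} {q : hom B A} :
  is_coalg_hom a b p -> q ∘ p = idm A -> p ∘ q = idm B -> is_coalg_hom b a q.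
Proof.
  intros [pd pe] qp pq; split.
  (* Both sides land in [A ⊗ A], so the split mono to cancel is [p ⊗₁ p]. *)
  - assert (qqpp : (q ⊗₁ q) ∘ (p ⊗₁ p) = idm (A ⊗ A))
      by (rewrite <- tens_comp, qp; apply tens_id).
    apply (mono_split_inv qqpp).
    rewrite !compA, <- pd, <- compA, pq, comp_idr, <- tens_comp, pq, tens_id.
    symmetry; apply comp_idl.
  - rewrite <- pe, <- compA, pq; apply comp_idr.
Qed.

(** Spares a direct check that the candidate inverse is a bialgebra morphism: it is built from
    [lambda], which need not be multiplicative. *)
Lemma bialg_iso_of_inverse {C : sym_mon_cat} {A B : bialgebra C}
    (p : bialg_hom A B) (q : hom B A) :
  q ∘ p = idm A -> p ∘ q = idm B -> is_bialg_iso p.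
Proof.
  intros qp pq.
  exists (BialgHom (alg_hom_inverse (bialg_hom_alg p) qp pq)
                   (coalg_hom_inverse (bialg_hom_coalg p) qp pq)).
  split; assumption.
Qed.

Theorem theorem2p20 (C : sym_mon_cat) (E E' : split_ext C)
    (g : bialg_hom (seB E) (seB E')) (v : bialg_hom (seX E) (seX E'))
    (p : bialg_hom (seA E) (seA E'))
    (hgvp : is_split_ext_hom g v p)
    (hv : is_bialg_iso v) (hg : is_bialg_iso g) :
  is_bialg_iso p.
Proof.
  destruct hgvp as [pk ps ap lp].
  destruct hv as [v' [v'v vv']], hg as [g' [g'g gg']].
  apply (bialg_iso_of_inverse p
    (bmul (seA E)
     ∘ ((kappa E ∘ v' ∘ lambda E') ⊗₁ (sec E ∘ g' ∘ alpha E'))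
     ∘ bcomul (seA E'))).
  (* Comultiplicativity moves [p] next to [lambda E'] and [alpha E']; passing it through them yields
     [v' ∘ v] and [g' ∘ g], which cancel. *)
  - assert (pd : bcomul (seA E') ∘ p = (p ⊗₁ p) ∘ bcomul (seA E))
      by apply (coalg_hom_comul (bialg_hom_coalg p)).
    rewrite <- compA, pd, compA, <- (compA (bmul (seA E))), <- tens_comp.
    rewrite <- (compA _ (lambda E')), lp, <- (compA _ (alpha E')), ap.
    rewrite <- (compA _ v'), (compA v'), v'v, comp_idl.
    rewrite <- (compA _ g'), (compA g'), g'g, comp_idl.
    apply split_decomp.
  (* Dually, multiplicativity moves [p] onto [kappa E] and [sec E], producing [v ∘ v'] and
     [g ∘ g']. *)
  - assert (pm : p ∘ bmul (seA E) = bmul (seA E') ∘ (p ⊗₁ p))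
      by apply (alg_hom_mul (bialg_hom_alg p)).
    rewrite !compA, pm, <- (compA (bmul (seA E'))), <- tens_comp, !compA.
    rewrite pk, ps, <- (compA _ v), vv', comp_idr.
    rewrite <- (compA _ g), gg', comp_idr.
    apply split_decomp.
Qed.
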